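(* For $n\in\mathbb{N}\cup\{0\}$ let $$P_n(x)=n!\sum_{k=0}^n\binom{n}{k}\frac{x(x-1)(x-2)\cdots(x-k+1)}{k!\,2^{n-k}}.$$ For every $n\in\mathbb{N}\cup\{0\}$ all (complex) zeros of the polynomial $P_n$ are simple and have real part equal to $-\frac12$. Equivalently, all zeros of the polynomial $S_n(x)=P_n\left(-\frac12+x\right)$ are simple and purely imaginary. Moreover, the zeros of the polynomials $P_n$ and $P_{n+1}$ interlace for all $n\in\mathbb{N}$. Equivalently, the zeros of the polynomials $S_n$ and $S_{n+1}$ interlace for all $n\in\mathbb{N}$.
   Context: The product $x(x-1)\cdots(x-k+1)$ is $1$ for $k=0$. $\mathbb{N}=\{1,2,3,\dots\}$. A zero is called purely imaginary if its real part is $0$ (so $0$ itself is allowed). Interlacing is understood along the vertical line containing the zeros (the line $\mathrm{Re}\,x=-\frac12$ for $P_n$, the imaginary axis for $S_n$): when zeros are ordered by imaginary part, strictly between any two consecutive zeros of the polynomial of index $n+1$ there is exactly one zero of the polynomial of index $n$. *)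

(* Defs.v *)
From HB Require Import structures.
From mathcomp Require Import all_boot all_order all_algebra.
From mathcomp Require Import reals.
From mathcomp.real_closed Require Export complex.

Set Implicit Arguments.
Unset Strict Implicit.
Unset Printing Implicit Defensive.

Import Order.TTheory GRing.Theory Num.Theory.
Local Open Scope ring_scope.

Section Polynomials.

Variable F : fieldType.

Definition falling_poly (k : nat) : {poly F} :=
  \prod_(j < k) ('X - (j%:R)%:P).

Definition Ppoly (n : nat) : {poly F} :=
  n`!%:R *: \sum_(k < n.+1)
     ('C(n, k)%:R / (k`!%:R * 2 ^+ (n - k)%N)) *: falling_poly k.

Definition Spoly (n : nat) : {poly F} :=
  Ppoly n \Po ((- 2^-1)%:P + 'X).

End Polynomials.

Section Zeros.

Variable R : realType.

Definition zeros_simple (p : {poly R[i]}) : Prop :=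
  forall z : R[i], root p z -> mup z p = 1%N.

Definition zeros_on_vline (c : R) (p : {poly R[i]}) : Prop :=
  forall z : R[i], root p z -> complex.Re z = c.

Definition consecutive_zeros (p : {poly R[i]}) (z w : R[i]) : Prop :=
  [/\ root p z, root p w, complex.Im z < complex.Im w &
      forall u : R[i], root p u -> ~~ (complex.Im z < complex.Im u < complex.Im w)].

(* Interlacing along the line Re x = c, where q is the polynomial of the
   larger index; imaginary parts order the zeros because these all lie on
   that line. *)
Definition interlace_on_vline (c : R) (p q : {poly R[i]}) : Prop :=
  [/\ zeros_on_vline c p, zeros_on_vline c q &
      forall z w : R[i], consecutive_zeros q z w ->
        exists! u : R[i], root p u /\ complex.Im z < complex.Im u < complex.Im w].

End Zeros.

(* Main.v *)
(* The three-term recurrence [S_(n+2) = x S_(n+1) + (n+1)^2/4 S_n] gives, for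
   [Re z <> 0], that [Re z * Re (S_(n+1)(z) conj (S_n(z)))] is positive, by
   induction on [n]; so no zero lies off the imaginary axis. On that axis
   [S_n('i y) = 'i^n T_n(y)] with [T_n] real and
   [T_(n+2) = y T_(n+1) - (n+1)^2/4 T_n]. The Wronskian
   [T_(n+1)' T_n - T_n' T_(n+1)] then satisfies a recurrence that keeps it
   positive on the real line, which forces the zeros to be simple and to
   interlace. *)
Require Import Defs.
From mathcomp Require Import all_boot all_order all_algebra.
From mathcomp Require Import reals.
From mathcomp Require Import ring zify.
From mathcomp.real_closed Require Import polyrcf.
Import Order.TTheory GRing.Theory Num.Theory.
Local Open Scope ring_scope.

Set Implicit Arguments.
Unset Strict Implicit.
Unset Printing Implicit Defensive.

(** * Three-term recurrence for [Ppoly] and [Spoly], through the falling-factorial expansion *)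

Section Recurrence.

Variable F : numFieldType.

(** The integer core of the recurrence for [Ppoly]: comparison of coefficients of
    [falling_poly k.+1] with factorials and powers of 2 cleared. *)
Lemma bin_recurrence (n k : nat) :
  (n.+2 * 'C(n.+2, k.+1) =
   k.+1 * 'C(n.+1, k) + k.+1.*2.+1 * 'C(n.+1, k.+1) + n.+1 * 'C(n, k.+1))%N.
Proof.
have down := mul_bin_down n.+1 k.+1; have left := mul_bin_left n.+1 k.
rewrite /= in down; rewrite down binS.
(* For [k <= n] the truncated subtractions in [down] and [left] are genuine. Beyond that, only
   [k = n.+1] leaves nonzero terms. *)
have [lek|gtk] := leqP k n; first by nia.
rewrite (@bin_small n.+1 k.+1) // !muln0 !addn0.
by have [->|nek] := eqVneq k n.+1; rewrite ?binn // bin_small ?muln0 // ltn_neqAle eq_sym nek.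
Qed.

(** Writing [2 ^+ (n - k)] as a quotient avoids truncated subtraction. The coefficient vanishes for
    [k > n], so sums for different [n] can share one range. *)
Definition falling_coef (n k : nat) : F :=
  n`!%:R * 'C(n, k)%:R * 2 ^+ k / (k`!%:R * 2 ^+ n).

Lemma Ppoly_falling (m n : nat) : (n < m)%N ->
  Ppoly F n = \sum_(k < m) falling_coef n k *: falling_poly F k.
Proof.
move=> ltnm; rewrite /Ppoly scaler_sumr.
rewrite (big_ord_widen m (fun k => n`!%:R *:
  (('C(n, k)%:R / (k`!%:R * 2 ^+ (n - k)%N)) *: falling_poly F k)) ltnm) big_mkcond.
apply: eq_bigr => k _; case: ltnP => [lekn|ltnk]; last first.
  by rewrite /falling_coef bin_small // mulr0 !mul0r scale0r.
rewrite scalerA; congr (_ *: _); rewrite /falling_coef.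
have kf0 : k`!%:R != 0 :> F by rewrite pnatr_eq0 -lt0n fact_gt0.
rewrite -[in 2 ^+ n](subnK (lekn : (k <= n)%N)) exprD; field.
by rewrite kf0 !expf_neq0 ?pnatr_eq0.
Qed.

Lemma mulX_falling (k : nat) :
  'X * falling_poly F k = falling_poly F k.+1 + k%:R *: falling_poly F k.
Proof. by rewrite /falling_poly big_ord_recr /= -mul_polyC; ring. Qed.

Lemma falling_coef0 (n : nat) : falling_coef n.+2 0 =
  2^-1 * falling_coef n.+1 0 + n.+1%:R ^+ 2 / 4 * falling_coef n 0.
Proof.
rewrite /falling_coef !bin0 !factS fact0 !natrM !expr0 !exprS; field.
by rewrite expf_neq0 ?pnatr_eq0.
Qed.

(** By [mulX_falling], multiplication by ['X + 2^-1] feeds [falling_poly k.+1] from index [k] with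
    weight 1 and from index [k.+1] with weight [k.+1 + 2^-1]. *)
Lemma falling_coefS (n k : nat) : falling_coef n.+2 k.+1 =
  falling_coef n.+1 k + (k.+1%:R + 2^-1) * falling_coef n.+1 k.+1
  + n.+1%:R ^+ 2 / 4 * falling_coef n k.+1.
Proof.
have kf0 : k`!%:R != 0 :> F by rewrite pnatr_eq0 -lt0n fact_gt0.
have e : n.+2%:R * 'C(n.+2, k.+1)%:R = k.+1%:R * 'C(n.+1, k)%:R +
    (2 * k.+1%:R + 1) * 'C(n.+1, k.+1)%:R + n.+1%:R * 'C(n, k.+1)%:R :> F.
  have -> : 2 * k.+1%:R + 1 = (k.+1.*2.+1)%:R :> F.
    by rewrite -[in RHS]natr1 -mul2n natrM.
  by rewrite -!natrM -!natrD bin_recurrence.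
rewrite /falling_coef !factS !natrM.
have -> : 'C(n.+2, k.+1)%:R = n.+2%:R^-1 * (n.+2%:R * 'C(n.+2, k.+1)%:R) :> F.
  by rewrite mulKf ?pnatr_eq0.
rewrite e !exprS; field.
by rewrite kf0 nat1r -natrD expf_neq0 ?pnatr_eq0.
Qed.

(** The second sum runs one index further, with a zero last term, so that it aligns with the first
    once index 0 is split off. *)
Lemma mulX_Ppoly (m n : nat) : (n < m)%N -> 'X * Ppoly F n =
  \sum_(k < m) falling_coef n k *: falling_poly F k.+1
  + \sum_(k < m.+1) (k%:R * falling_coef n k) *: falling_poly F k.
Proof.
move=> ltnm; rewrite (Ppoly_falling ltnm) big_ord_recr /= [falling_coef n m]/falling_coef.
rewrite bin_small // !(mulr0, mul0r) scale0r addr0 mulr_sumr -big_split /=.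
apply: eq_bigr => k _.
by rewrite -scalerAr mulX_falling scalerDr scalerA [_ * k%:R]mulrC.
Qed.

Lemma Ppoly_recurrence (n : nat) :
  Ppoly F n.+2 = ('X + (2^-1)%:P) * Ppoly F n.+1 + (n.+1%:R ^+ 2 / 4)%:P * Ppoly F n.
Proof.
rewrite mulrDl (@mulX_Ppoly n.+2) // (@Ppoly_falling n.+3 n.+2) //.
rewrite (@Ppoly_falling n.+3 n.+1) // (Ppoly_falling (leqW (leqW (ltnSn n)))).
rewrite !mul_polyC !scaler_sumr -!addrA -!big_split /= [in LHS]big_ord_recl.
rewrite [X in _ = _ + X]big_ord_recl [RHS]addrCA -big_split /=; congr (_ + _).
  by rewrite mul0r scale0r add0r !scalerA -scalerDl -falling_coef0.
apply: eq_bigr => k _; rewrite !scalerA -!scalerDl falling_coefS.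
by congr (_ *: _); rewrite /bump /=; ring.
Qed.

Lemma Ppoly0 : Ppoly F 0 = 1.
Proof.
rewrite (@Ppoly_falling 1) // big_ord1 /falling_coef /falling_poly big_ord0.
by rewrite bin0 fact0 !expr0 !mulr1 divr1 scale1r.
Qed.

Lemma Ppoly1 : Ppoly F 1 = 'X + (2^-1)%:P.
Proof.
rewrite (@Ppoly_falling 2) // !big_ord_recl big_ord0 /falling_coef /falling_poly.
rewrite !big_ord_recl !big_ord0 /= !mulr1 !expr1 !mul1r divff ?pnatr_eq0 //.
by rewrite scale1r alg_polyC subr0 addr0 addrC.
Qed.

Lemma Spoly0 : Spoly F 0 = 1.
Proof. by rewrite /Spoly Ppoly0 comp_polyC. Qed.

Lemma Spoly1 : Spoly F 1 = 'X.
Proof. by rewrite /Spoly Ppoly1 comp_polyD comp_polyX comp_polyC polyCN; ring. Qed.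

Lemma Spoly_recurrence (n : nat) :
  Spoly F n.+2 = 'X * Spoly F n.+1 + (n.+1%:R ^+ 2 / 4)%:P * Spoly F n.
Proof.
rewrite /Spoly Ppoly_recurrence comp_polyD !comp_polyM comp_polyD !comp_polyC.
by rewrite comp_polyX polyCN; congr (_ * _ + _); ring.
Qed.

End Recurrence.

(** * Real polynomials with positive Wronskian: simple roots and interlacing *)

Section RealModel.

Variable R : rcfType.

(* [Spoly n] evaluated at ['i y] is ['i ^ n] times this polynomial at [y]. *)
Fixpoint Tpoly (n : nat) : {poly R} :=
  if n is m.+1 then
    if m is k.+1 then 'X * Tpoly m - (m%:R ^+ 2 / 4)%:P * Tpoly k else 'X
  else 1.

Lemma Tpoly_recurrence (n : nat) :
  Tpoly n.+2 = 'X * Tpoly n.+1 - (n.+1%:R ^+ 2 / 4)%:P * Tpoly n.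
Proof. by []. Qed.

Lemma recurrence_coef_gt0 (n : nat) : 0 < n.+1%:R ^+ 2 / 4 :> R.
Proof. by rewrite divr_gt0 ?exprn_gt0 ?ltr0n. Qed.

Definition wronskian (p q : {poly R}) : {poly R} := q^`() * p - p^`() * q.

Lemma wronskian_Tpoly_gt0 (n : nat) (y : R) :
  0 < (wronskian (Tpoly n) (Tpoly n.+1)).[y].
Proof.
elim: n => [|n IHn].
  by rewrite /wronskian /= derivX -polyC1 derivC mul0r subr0 mulr1 hornerC ltr01.
have -> : (wronskian (Tpoly n.+1) (Tpoly n.+2)).[y] = (Tpoly n.+1).[y] ^+ 2
    + n.+1%:R ^+ 2 / 4 * (wronskian (Tpoly n) (Tpoly n.+1)).[y].
  rewrite Tpoly_recurrence /wronskian derivB !derivM derivX derivC !hornerE.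
  by ring.
exact: ltr_wpDl (sqr_ge0 _) (mulr_gt0 (recurrence_coef_gt0 _) IHn).
Qed.

Section WronskianPositive.

Variables p q : {poly R}.
Hypothesis Wgt0 : forall x, 0 < (wronskian p q).[x].

Lemma simple_roots_of_wronskian (x : R) :
  (root p x -> p^`().[x] != 0) /\ (root q x -> q^`().[x] != 0).
Proof.
have := Wgt0 x; rewrite /wronskian !hornerE => W.
by split=> /rootP e; apply: contraTneq W => ->; rewrite e !(mul0r, mulr0) subrr ltxx.
Qed.

(* Factor [q = (X - a) (X - b) g]: the Wronskian at [a] and [b] shows that
   [g p] changes sign between [a] and [b]. *)
Lemma root_between_consecutive (a b : R) : a < b -> root q a -> root q b ->
  {in `]a, b[, forall x, ~~ root q x} -> exists2 u, u \in `]a, b[ & root p u.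
Proof.
move=> ltab qa qb noroot.
have /factor_theorem[h qE] := qa.
have : root h b.
  by move: qb; rewrite qE rootM root_XsubC (gt_eqF ltab) orbF.
case/factor_theorem => g hE; rewrite hE in qE.
have Wa := Wgt0 a; have Wb := Wgt0 b.
have : (g * p).[a] * (g * p).[b] < 0.
  have ba : 0 < b - a by rewrite subr_gt0.
  have WaE : (wronskian p q).[a] = - (g.[a] * p.[a] * (b - a)).
    rewrite /wronskian qE !derivM !derivXsubC !mulr1.
    by rewrite !(hornerD, hornerN, hornerM, hornerX, hornerC); ring.
  have WbE : (wronskian p q).[b] = g.[b] * p.[b] * (b - a).
    rewrite /wronskian qE !derivM !derivXsubC !mulr1.
    by rewrite !(hornerD, hornerN, hornerM, hornerX, hornerC); ring.
  move: Wa Wb; rewrite WaE WbE oppr_gt0 pmulr_lgt0 // pmulr_llt0 // !hornerM.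
  by move=> ga gb; rewrite nmulr_rlt0.
case/(poly_ivtoo (ltW ltab)) => u uab; rewrite rootM => /orP[gu|pu]; last by exists u.
by have := noroot u uab; rewrite qE !rootM gu.
Qed.

Lemma root_between (a b : R) : a < b -> root q a -> root q b ->
  exists2 u, u \in `]a, b[ & root p u.
Proof.
move=> ltab qa qb.
(* Either [q] is zero, which makes the Wronskian vanish, or [a] is followed by a first root [y] of
   [q] before [b], or [a] and [b] are themselves consecutive. *)
case: (next_rootP q a b) => [q0|y _ qy yab noroot|c _ _ noroot].
- by have := Wgt0 a; rewrite /wronskian q0 deriv0 mul0r mulr0 subrr horner0 ltxx.
- have /andP[ay yb] : a < y < b by move: yab; rewrite in_itv.
  have [|u uay pu] := root_between_consecutive ay qa _ noroot; first exact/rootP.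
  by exists u => //; move: uay; rewrite !in_itv /= => /andP[-> /lt_trans->].
- exact: root_between_consecutive.
Qed.

End WronskianPositive.

(** This symmetry lets [root_between] also produce roots of [q] between roots of [p]. *)
Lemma wronskian_swap (p q : {poly R}) : wronskian q (- p) = wronskian p q.
Proof. by rewrite /wronskian derivN; ring. Qed.

(** Two distinct roots of [p] in the interval would enclose a root of [q], by [root_between] applied
    to [q] and [- p]. *)
Lemma unique_root_between (p q : {poly R}) (a b u v : R) :
    (forall x, 0 < (wronskian p q).[x]) -> {in `]a, b[, forall x, ~~ root q x} ->
  root p u -> root p v -> u \in `]a, b[ -> v \in `]a, b[ -> u = v.
Proof.
move=> Wgt0 noroot.
have no_lt u1 v1 : root p u1 -> root p v1 -> u1 \in `]a, b[ -> v1 \in `]a, b[ ->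
    ~~ (u1 < v1).
  rewrite -rootN -[root p v1]rootN !in_itv /= => pu pv /andP[au _] /andP[_ vb].
  apply/negP => ltuv.
  have [|x] := @root_between q (- p) _ u1 v1 ltuv pu pv.
    by move=> x; rewrite wronskian_swap.
  rewrite in_itv /= => /andP[ux xv]; apply/negP/noroot.
  by rewrite in_itv /= (lt_trans au ux) (lt_trans xv vb).
move=> pu pv uab vab; apply/eqP; rewrite eq_le !leNgt.
by rewrite !no_lt.
Qed.

End RealModel.

(** * Transfer from the real line to vertical lines in the complex plane *)

Section VerticalLine.

Variable R : realType.
Local Notation C := R[i].
Local Notation toC := (real_complex R).

Lemma mup_simple (p : {poly C}) (z : C) : root p z -> p^`().[z] != 0 -> mup z p = 1%N.
Proof.
case/factor_theorem => g ->; rewrite derivM derivXsubC mulr1 hornerD hornerM.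
rewrite hornerXsubC subrr mulr0 add0r => gz.
by rewrite mupMr // -[_ - _]expr1 mup_XsubCX eqxx.
Qed.

(* On the line [Re x = c], parametrized by [y |-> c + 'i y], the polynomial [p]
   is proportional to the real polynomial [T]. *)
Definition vline_model (c : R) (p : {poly C}) (T : {poly R}) : Prop :=
  exists2 d : C, d != 0 & p \Po ((toC c)%:P + 'i%C%:P * 'X) = d%:P * map_poly toC T.

Lemma vline_eta (c : R) (z : C) : complex.Re z = c -> z = (c +i* complex.Im z)%C.
Proof. by case: z => x y /= ->. Qed.

Lemma vline_point (c y : R) :
  ((toC c)%:P + 'i%C%:P * 'X).[toC y] = (c +i* y)%C.
Proof. by rewrite !hornerE; simpc. Qed.

Lemma vline_root (c : R) p T (y : R) : vline_model c p T ->
  root p (c +i* y)%C = root T y.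
Proof.
case=> d d0 e; rewrite -vline_point /root -horner_comp e hornerM hornerC.
by rewrite horner_map mulf_eq0 (negPf d0) fmorph_eq0.
Qed.

Lemma vline_deriv (c : R) p T (y : R) : vline_model c p T ->
  T^`().[y] != 0 -> p^`().[(c +i* y)%C] != 0.
Proof.
case=> d d0 /(congr1 (fun q => q^`().[toC y])).
rewrite deriv_comp hornerM horner_comp vline_point derivM derivC mul0r add0r.
rewrite hornerM hornerC deriv_map horner_map => e T'y.
suff: p^`().[(c +i* y)%C] * ((toC c)%:P + 'i%C%:P * 'X)^`().[toC y] != 0.
  by rewrite mulf_eq0 negb_or => /andP[].
by rewrite e mulf_neq0 // fmorph_eq0.
Qed.

Lemma vline_simple (c : R) p T : vline_model c p T -> zeros_on_vline c p ->
  (forall y, root T y -> T^`().[y] != 0) -> zeros_simple p.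
Proof.
move=> model line simple z pz; apply: mup_simple => //.
move: (pz); rewrite (vline_eta (line z pz)) (vline_root _ model) => Ty.
exact/(vline_deriv model)/simple.
Qed.

Lemma vline_interlace (c : R) p q Tp Tq :
    vline_model c p Tp -> vline_model c q Tq ->
    zeros_on_vline c p -> zeros_on_vline c q ->
  (forall y, 0 < (wronskian Tp Tq).[y]) -> interlace_on_vline c p q.
Proof.
move=> modelp modelq linep lineq Wgt0; split=> // z w [qz qw ltzw noroot].
move: (qz) (qw); rewrite (vline_eta (lineq z qz)) (vline_eta (lineq w qw)).
rewrite !(vline_root _ modelq) => Tz Tw.
have [u uzw Tu] := root_between Wgt0 ltzw Tz Tw.
exists (c +i* u)%C; split.
  by rewrite (vline_root _ modelp); move: uzw; rewrite in_itv.
move=> v [pv vzw]; rewrite (vline_eta (linep v pv)); congr (_ +i* _)%C.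
apply: (unique_root_between Wgt0 _ Tu _ uzw).
- move=> x xzw; apply/negP; rewrite -(vline_root x modelq) => /noroot.
  by move: xzw; rewrite in_itv /= => ->.
- by rewrite -(vline_root _ modelp) -(vline_eta (linep v pv)).
- by rewrite in_itv.
Qed.

Lemma recurrence_coef_real (n : nat) :
  toC (n.+1%:R ^+ 2 / 4) = n.+1%:R ^+ 2 / 4 :> C.
Proof. by rewrite fmorph_div rmorphXn !rmorph_nat. Qed.

Lemma Spoly_model (n : nat) : vline_model 0 (Spoly C n) (Tpoly R n).
Proof.
exists ('i%C ^+ n); first by rewrite expf_neq0 // neq0Ci.
rewrite raddf0 add0r; elim/ltn_ind: n => -[|[|n]] IHn.
- by rewrite Spoly0 !rmorph1 mulr1.
- by rewrite Spoly1 comp_polyX map_polyX expr1.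
rewrite Spoly_recurrence Tpoly_recurrence comp_polyD !comp_polyM comp_polyX comp_polyC.
rewrite !IHn // rmorphB !(rmorphM (map_poly toC)) /=.
rewrite map_polyX map_polyC /= recurrence_coef_real.
rewrite !exprS !polyCM.
(* The square of ['i] accounts for the opposite signs of the last terms in the recurrences of
   [Spoly] and [Tpoly]. *)
have ii : 'i%C%:P * 'i%C%:P = -1 :> {poly C} by rewrite -polyCM -expr2 sqr_i polyCN.
by ring: ii.
Qed.

(* The bracket is [Re (v * conj u)]. *)
Lemma Spoly_dot_gt0 (n : nat) (z : C) : complex.Re z != 0 ->
  let u := (Spoly C n).[z] in let v := (Spoly C n.+1).[z] in
  0 < complex.Re z * (complex.Re u * complex.Re v + complex.Im u * complex.Im v).
Proof.
move=> x0; elim: n => [|n]; cbv zeta.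
  by rewrite Spoly0 Spoly1 hornerC hornerX /= mul1r mul0r addr0 -expr2 exprn_even_gt0.
rewrite Spoly_recurrence !(hornerD, hornerM, hornerX, hornerC) -recurrence_coef_real.
have k_gt0 := recurrence_coef_gt0 R n.
move: (_ / 4) k_gt0 x0 => k; case: z => x y /=.
move: (Spoly C n).[_] (Spoly C n.+1).[_] => [a b] [c d] /= k0 x0 IHn.
(* With [u = a + 'i b], [v = c + 'i d] and next value [z * v + k * u], this is [Re ((z * v + k * u)
   * conj v) = x * |v|^2 + k * Re (u * conj v)] multiplied by [x]. The zeros are the imaginary part
   of [k]. *)
have -> : x * (c * (x * c - y * d + (k * a - 0 * b)) +
    d * (x * d + y * c + (k * b + 0 * a))) =
    x ^+ 2 * (c ^+ 2 + d ^+ 2) + k * (x * (a * c + b * d)) by ring.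
apply: ltr_wpDl (mulr_gt0 k0 IHn).
by apply: mulr_ge0; rewrite ?addr_ge0 ?sqr_ge0.
Qed.

Lemma Spoly_zeros (n : nat) : zeros_on_vline 0 (Spoly C n).
Proof.
move=> z /rootP Sz0; apply/eqP; apply: contraT => /(Spoly_dot_gt0 n) /=.
by rewrite Sz0 /= !mul0r addr0 mulr0 ltxx.
Qed.

Lemma Ppoly_Spoly (n : nat) : Ppoly C n = Spoly C n \Po ('X + (2^-1)%:P).
Proof.
rewrite /Spoly -comp_polyA comp_polyD comp_polyC comp_polyX.
by rewrite polyCN addrCA addNr addr0 comp_polyXr.
Qed.

Lemma neg_half_real : toC (- 2^-1) = - 2^-1.
Proof. by rewrite rmorphN fmorphV rmorph_nat. Qed.

(** Translation by [2^-1] carries this line to the imaginary axis, so the real model and the factor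
    [d] of [Spoly n] serve again. *)
Lemma Ppoly_model (n : nat) : vline_model (- 2^-1) (Ppoly C n) (Tpoly R n).
Proof.
have [d d0 e] := Spoly_model n; exists d => //; rewrite -e Ppoly_Spoly -comp_polyA.
congr (_ \Po _); rewrite comp_polyD comp_polyX comp_polyC neg_half_real raddf0 polyCN.
by ring.
Qed.

Lemma Ppoly_zeros (n : nat) : zeros_on_vline (- 2^-1) (Ppoly C n).
Proof.
move=> z; rewrite Ppoly_Spoly /root horner_comp => /Spoly_zeros.
rewrite !hornerE.
(* Expressing [2^-1] through an embedded real number lets the real part of the equation be read off
   by computation. *)
rewrite -[2^-1 in X in X -> _]opprK -neg_half_real; case: z => x y /= /eqP.
by rewrite subr_eq0 => /eqP.
Qed.

Lemma Tpoly_simple (n : nat) (y : R) : root (Tpoly R n) y -> (Tpoly R n)^`().[y] != 0.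
Proof. by have [] := simple_roots_of_wronskian (wronskian_Tpoly_gt0 n) y. Qed.

End VerticalLine.

Theorem theorem5p11 (R : realType) :
  [/\ forall n : nat,
        zeros_simple (Ppoly R[i] n) /\ zeros_on_vline (- 2^-1 : R) (Ppoly R[i] n),
      forall n : nat,
        zeros_simple (Spoly R[i] n) /\ zeros_on_vline (0 : R) (Spoly R[i] n),
      forall n : nat, (1 <= n)%N ->
        interlace_on_vline (- 2^-1 : R) (Ppoly R[i] n) (Ppoly R[i] n.+1)
    & forall n : nat, (1 <= n)%N ->
        interlace_on_vline (0 : R) (Spoly R[i] n) (Spoly R[i] n.+1)].
Proof.
split=> [n|n|n _|n _].
- split; last exact: Ppoly_zeros.
  exact: vline_simple (Ppoly_model R n) (@Ppoly_zeros R n) (@Tpoly_simple R n).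
- split; last exact: Spoly_zeros.
  exact: vline_simple (Spoly_model R n) (@Spoly_zeros R n) (@Tpoly_simple R n).
- apply: vline_interlace (Ppoly_model R n) (Ppoly_model R n.+1) _ _ _;
    try exact: Ppoly_zeros; exact: wronskian_Tpoly_gt0.
- apply: vline_interlace (Spoly_model R n) (Spoly_model R n.+1) _ _ _;
    try exact: Spoly_zeros; exact: wronskian_Tpoly_gt0.
Qed.
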